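(* Let $m\geq 2$, let $Q_{4m}=\langle a,b\mid a^{2m}=1,\ b^{2}=a^{m},\ bab^{-1}=a^{-1}\rangle$ be the generalized quaternion group of order $4m$, let $V$ be a rational FPF representation of $Q_{4m}$ of dimension $n=\dim_{\mathbb{Q}}V$, let $L\subset V$ be a $Q_{4m}$-invariant full-rank lattice, and consider the induced $Q_{4m}$-action on $V_{\mathbb{C}}/L$. Let $F$ be the set of points of $V_{\mathbb{C}}/L$ with nontrivial stabilizer. Then \[|F|=1-\omega(2m)+\sum_{p\mid 2m}p^{\frac{n}{p-1}},\] where $p$ ranges over the distinct prime divisors of $2m$ and $\omega(2m)$ is the number of distinct prime divisors of $2m$.
   Context: A rational FPF (fixed-point-free) representation of a finite group $G$ is a nonzero finite-dimensional $\mathbb{Q}$-vector space $V$ with a linear $G$-action such that $\det(g-\mathrm{id}\mid V)\neq 0$ for every non-identity $g\in G$. A $G$-invariant full-rank lattice $L\subset V$ is a $G$-stable free $\mathbb{Z}$-submodule spanned by a $\mathbb{Q}$-basis of $V$. Put $V_{\mathbb{C}}=V\otimes_{\mathbb{Q}}\mathbb{C}$; the action of $G$ extends $\mathbb{C}$-linearly to $V_{\mathbb{C}}$ and induces an action on the torus $V_{\mathbb{C}}/L\cong(\mathbb{C}/\mathbb{Z})^n$ by $g\cdot[x]=[gx]$. *)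

(* Defs.v *)
From mathcomp Require Import all_boot all_order all_algebra all_fingroup.
From mathcomp Require Import all_solvable all_field all_character.
From mathcomp Require Export complex.
From mathcomp Require Import all_classical all_reals all_analysis.

Set Implicit Arguments.
Unset Strict Implicit.
Unset Printing Implicit Defensive.

Import Order.TTheory GRing.Theory Num.Theory.

Local Open Scope classical_set_scope.
Local Open Scope ring_scope.

(* Representations act on column vectors, g . v := rG g *m v, so that they are *)
(* left actions: rG (g * h) = rG g *m rG h.                                   *)

Section Representation.
Variables (gT : finGroupType) (G : {group gT}) (n : nat).

Definition rational_FPF (rG : mx_representation rat G n) : Prop :=
  (0 < n)%N /\
  (forall g : gT, g \in G -> g != 1%g -> \det (rG g - 1%:M) != 0).

Definition full_rank_lattice (L : set 'cV[rat]_n) : Prop :=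
  exists2 e : n.-tuple 'cV[rat]_n, basis_of fullv e &
    L = [set \sum_(i < n) e`_i *~ z i | z in [set: 'I_n -> int]].

Definition invariant_set (rG : mx_representation rat G n)
    (L : set 'cV[rat]_n) : Prop :=
  forall (g : gT) (v : 'cV[rat]_n), g \in G -> L v -> L (rG g *m v).

End Representation.

(* With V = Q^n, the space V_C is C^n, V embeds in it entrywise by ratr, and a *)
(* point of V_C / L is a coset x + L, i.e. a subset of C^n.                   *)

Section Torus.
Variables (R : realType) (gT : finGroupType) (G : {group gT}) (n : nat).
Implicit Types (L : set 'cV[rat]_n) (X : set 'cV[R[i]]_n).

Definition torus_class L (x : 'cV[R[i]]_n) : set 'cV[R[i]]_n :=
  [set x + map_mx ratr v | v in L].

Definition torus L : set (set 'cV[R[i]]_n) := range (torus_class L).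

Variable rG : mx_representation rat G n.

Definition torus_act (g : gT) X : set 'cV[R[i]]_n :=
  [set map_mx ratr (rG g) *m x | x in X].

(* The direct image of a coset by g is g . [x] = [g x].                       *)
Lemma torus_act_class L (g : gT) (x : 'cV[R[i]]_n) :
    invariant_set rG L -> g \in G ->
  torus_act g (torus_class L x)
    = torus_class L (map_mx ratr (rG g) *m x).
Proof.
move=> stL Gg; apply/seteqP; split=> [_ [_ [v Lv <-] <-]|_ [v Lv <-]].
  by exists (rG g *m v); [exact: stL | rewrite map_mxM mulmxDr].
exists (x + map_mx ratr (rG g^-1%g *m v)).
  by exists (rG g^-1%g *m v) => //; apply: stL; rewrite ?groupV.
by rewrite mulmxDr -map_mxM mulmxA -repr_mxM ?groupV// mulgV repr_mx1 mul1mx.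
Qed.

Definition torus_stabilizer X : {set gT} :=
  [set g in G | `[< torus_act g X = X >]]%SET.

Definition nontrivial_stabilizer_points L : set (set 'cV[R[i]]_n) :=
  [set X | torus L X /\ torus_stabilizer X != 1%g].

End Torus.

Arguments torus R {n} L.
Arguments nontrivial_stabilizer_points R {gT G n} rG L.

(* Main.v *)
(* A point [x] with nontrivial stabilizer is fixed by some g of prime order p; *)
(* in Q_4m such a g lies in <a>, and it generates the unique subgroup of order *)
(* p of <a>.  So F is the union over p | 2m of the fixed loci of               *)
(* g_p = a^(2m/p).  Since g_p - 1 is invertible, 1 + g_p + ... + g_p^(p-1) is  *)
(* 0, so the product of the 1 - g_p^i for 0 < i < p is p, as in Z[zeta_p].  On *)
(* the torus, kernels of composites of isogenies have multiplicative orders,   *)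
(* each 1 - g_p^i has the same kernel (the fixed locus), and multiplication by *)
(* p has p^n points in its kernel: the fixed locus has p^(n/(p-1)) points, all *)
(* killed by p, so that two of these loci only meet at 0.                      *)

Require Import Defs.
From mathcomp Require Import all_boot all_order all_algebra all_fingroup.
From mathcomp Require Import all_solvable all_field all_character.
From mathcomp Require Import finmap.
From mathcomp Require Import all_classical all_reals all_analysis.

Import Order.TTheory GRing.Theory Num.Theory.

Local Open Scope classical_set_scope.
Local Open Scope ring_scope.

Set Implicit Arguments.
Unset Strict Implicit.
Unset Printing Implicit Defensive.

(** The count rests on three facts. Group side: elements of $Q_{4m}$ outside $\langle a\rangle$ have
    order 4, so every element of prime order lies in the cyclic group $\langle a\rangle$ of order
    $2m$ ([quaternion_presentation_cyclic]), and $F$ is the union over $p\mid 2m$ of the fixed loci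
    of $g_p=a^{2m/p}$ ([nontrivial_stabilizer_pointsE]).

    Each locus: it is the kernel $K$ of $1-g_p$ on the torus. Substituting $g_p$ into a cyclotomic
    identity gives $\prod_{0<i<p}(1-g_p^i)=p$ ([prod_1_sub_exprM]). All $p-1$ factors have kernel
    $K$, orders of kernels multiply along compositions, and multiplication by $p$ has kernel of
    order $p^n$; hence $|K|^{p-1}=p^n$ ([card_fixed_classes_expr]).

    Assembly: $K$ is killed by $p$, so loci for distinct primes share only $0$
    ([fixed_classes_disjoint]). A union of $\omega(2m)$ sets glued at one point counts that point
    once instead of $\omega(2m)$ times ([card_bouquet]), whence the term $1-\omega(2m)$. *)

(** * Order and prime-order elements of the presented group *)

(* The left regular representation of Q_4m on normal forms: (i, j) stands for *)
(* a^i b^j, with i read modulo 2m.                                            *)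
Definition quaternion_rot (m : nat) (x : 'Z_(2 * m) * bool) :
    'Z_(2 * m) * bool :=
  (x.1 + 1, x.2).

Definition quaternion_flip (m : nat) (x : 'Z_(2 * m) * bool) :
    'Z_(2 * m) * bool :=
  ((if x.2 then m%:R else 0) - x.1, ~~ x.2).

Lemma quaternion_rot_inj m : injective (@quaternion_rot m).
Proof. by move=> [i j] [k l] /pair_equal_spec[/= /addIr-> ->]. Qed.

Lemma quaternion_flip_inj m : injective (@quaternion_flip m).
Proof.
move=> [i j] [k l] /pair_equal_spec[/= + /negb_inj jl].
by rewrite jl => /addrI/oppr_inj->.
Qed.

(** The presentation alone does not exclude collapse. By its universal property $G$ maps onto any
    group whose generators satisfy the relations; here that group acts transitively on the $4m$
    normal forms. *)
Lemma quaternion_presentation_card_ge m (gT : finGroupType) (G : {group gT}) :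
    (0 < m)%N ->
    (G \isog Grp (a : b : a ^+ (2 * m), b ^+ 2 = a ^+ m,
                          b * a * b^-1 = a^-1))%g ->
  (4 * m <= #|G|)%N.
Proof.
move=> m_gt0 isoG.
have N_gt1 : (1 < 2 * m)%N by rewrite leq_pmulr.
pose A := perm (@quaternion_rot_inj m); pose B := perm (@quaternion_flip_inj m).
have AX k x : (A ^+ k)%g x = (x.1 + k%:R, x.2).
  rewrite permX; elim: k x => [[i j]|k IH x] /=; first by rewrite addr0.
  by rewrite IH permE /quaternion_rot /= -addrA natr1.
have Nm : - (m%:R : 'Z_(2 * m)) = m%:R.
  by apply: addr0_eq; rewrite -natrD addnn -mul2n pchar_Zp.
have homMG : (<[A]> <*> <[B]> \homg G)%g.
  rewrite isoG; apply/existsP; exists (A, B); rewrite /= !xpair_eqE.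
  apply/and4P; split => //; apply/eqP.
  - by apply/permP=> -[i j]; rewrite AX perm1 pchar_Zp // addr0.
  - apply/permP=> -[i j]; rewrite AX permX /= !permE /quaternion_flip /=.
    case: j => //=; last by rewrite sub0r opprK addrC.
    by rewrite sub0r opprB Nm.
  apply: (mulIg B); rewrite mulgKV; apply: (mulgI A); rewrite mulKVg.
  apply/permP=> -[i j]; rewrite !permM !permE /quaternion_flip /quaternion_rot /=.
  by rewrite opprD addrA subrK.
apply: leq_trans (leq_homg homMG).
pose f (s : {perm 'Z_(2 * m) * bool}) := s (0, false).
have <- : #|{: 'Z_(2 * m) * bool}| = (4 * m)%N.
  by rewrite card_prod card_bool card_ord Zp_cast // mulnC mulnA.
rewrite -cardsT; apply: leq_trans (leq_imset_card f _).
apply/subset_leq_card/fintype.subsetP=> -[i j] _; apply/imsetP.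
have MA k : (A ^+ k \in <[A]> <*> <[B]>)%g.
  by rewrite groupX // mem_gen // inE cycle_id.
case: j; last by exists (A ^+ (i : nat))%g; rewrite // /f AX /= add0r natr_Zp.
(* The flip sends $(c,0)$ to $(-c,1)$, so the index is written as an opposite. *)
have [c ->] : exists c : 'Z_(2 * m), i = - c by exists (- i); rewrite opprK.
exists (A ^+ (c : nat) * B)%g.
  by rewrite groupM // mem_gen // inE cycle_id orbT.
by rewrite /f permM AX permE /quaternion_flip /= !add0r natr_Zp.
Qed.

(** $\langle a\rangle$ is normal with at most two cosets, so $|G|\geq 4m$ forces $a$ to have order
    exactly $2m$. An element $h=a^kb$ satisfies $h^2=b^2=a^m\neq 1$ and $h^4=1$, so its order is not
    prime. *)
Lemma quaternion_presentation_cyclic m (gT : finGroupType) (G : {group gT}) :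
    (0 < m)%N ->
    (G \isog Grp (a : b : a ^+ (2 * m), b ^+ 2 = a ^+ m,
                          b * a * b^-1 = a^-1))%g ->
  exists a : gT, [/\ a \in G, #[a]%g = (2 * m)%N &
    forall h, h \in G -> prime #[h]%g -> h \in <[a]>%g].
Proof.
move=> m_gt0 isoG; have geG := quaternion_presentation_card_ge m_gt0 isoG.
have /existsP[[a b] /=] := isoGrp_hom isoG.
rewrite !xpair_eqE => /and4P[/eqP defG /eqP aN /eqP b2 /eqP bab].
have abV : (a ^ b^-1 = a^-1)%g by rewrite conjgE invgK mulgA.
have nab : (b \in 'N(<[a]>))%g.
  by rewrite -groupV -cycle_subG norms_cycle abV groupV cycle_id.
have defG' : (<[a]> * <[b]>)%g = G.
  by rewrite -defG norm_joinEr ?cycle_subG.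
have Ga : a \in G by rewrite -cycle_subG -defG' mulG_subl.
have le_a : (#[a]%g <= 2 * m)%N.
  by rewrite dvdn_leq ?muln_gt0 // order_dvdn aN.
have b2a : (b ^+ 2 \in <[a]>)%g by rewrite b2 mem_cycle.
have elt h : h \in G -> exists k, h = (a ^+ k)%g \/ h = (a ^+ k * b)%g.
  rewrite -defG' => /mulsgP[x y /cycleP[k ->] /cycleP[l ->] ->].
  rewrite -(odd_double_half l) expgD -mul2n expgM.
  have /cycleP[t ->] : ((b ^+ 2) ^+ l./2 \in <[a]>)%g by rewrite groupX.
  case: (odd l); last by exists (k + t)%N; left; rewrite mul1g -expgD.
  have /cycleP[t' e] : ((a ^+ t) ^ b^-1 \in <[a]>)%g.
    by rewrite memJ_norm ?groupV // mem_cycle.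
  exists (k + t')%N; right; rewrite expgD -e conjgE invgK.
  by rewrite expg1 !mulgA mulgKV.
have ge_a : (2 * m <= #[a]%g)%N.
  have sG : G \subset (<[a]> :|: <[a]> :* b)%g.
    apply/fintype.subsetP=> h /elt[k [] ->]; rewrite inE ?mem_cycle //.
    by rewrite mem_rcoset mulgK mem_cycle orbT.
  rewrite -(leq_pmul2l (isT : 0 < 2)%N) mulnA (leq_trans geG) //.
  rewrite (leq_trans (subset_leq_card sG))// (leq_trans (leq_card_setU _ _)) //.
  by rewrite card_rcoset addnn mul2n.
have oa : #[a]%g = (2 * m)%N by apply/eqP; rewrite eqn_leq le_a.
exists a; split=> // h Gh pr_h; have [k [->|def_h]] := elt h Gh.
  exact: mem_cycle.
have h2 : (h ^+ 2 = a ^+ m)%g.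
  have e : (b * a ^+ k = a ^- k * b)%g.
    apply: (mulIg b^-1)%g; rewrite mulgK.
    by rewrite -expgVn -abV -conjXg conjgE invgK !mulgA.
  rewrite def_h expgS expg1 -mulgA [(b * (_ * _))%g]mulgA e.
  by rewrite !mulgA mulgV mul1g.
have am1 : (a ^+ m != 1)%g.
  by rewrite -order_dvdn oa gtnNdvd // ltn_Pmull.
(* A prime dividing $4=2^2$ divides $2$, which would give $h^2=1$. *)
have : (#[h]%g %| 4)%N.
  by rewrite order_dvdn (expgM h 2 2) h2 -expgM mulnC aN.
rewrite (_ : 4 = 2 ^ 2)%N // Euclid_dvdX // andbT order_dvdn h2.
by rewrite (negPf am1).
Qed.

(** * The cyclotomic identity and its matrix form *)

(** Cancel $X-1$ in the factorization of $X^p-1$ and evaluate at $1$: the cofactor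
    $1+X+\dots+X^{p-1}$ takes the value $p$. *)
Lemma prod_1_sub_prim_root (F : fieldType) p (z : F) :
    (0 < p)%N -> p.-primitive_root z ->
  \prod_(1 <= i < p) (1 - z ^+ i) = p%:R.
Proof.
move=> p_gt0 z_prim.
have := factor_Xn_sub_1 z_prim; rewrite subrX1 big_ltn // expr0 polyC1.
move/(mulfI (negbT (polyXsubC_eq0 1)))/(congr1 (horner^~ 1)).
rewrite horner_prod horner_sum => e.
under eq_bigr => i _ do rewrite -[1 - _]hornerXsubC.
rewrite e (eq_bigr (fun=> 1)) => [|i _]; last by rewrite hornerXn expr1n.
by rewrite sumr_const card_ord.
Qed.

(** Over [algC] the roots of $1+X+\dots+X^{p-1}$ are the distinct powers $z^k$, $0<k<p$, of a
    primitive root. As $p$ is prime each is again primitive, hence a root of the difference [P];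
    divisibility then descends to the rationals. *)
Lemma prod_1_sub_Xn_cyclotomic p : prime p ->
  exists q : {poly rat},
    \prod_(1 <= i < p) (1 - 'X^i) = p%:R + q * \sum_(i < p) 'X^i.
Proof.
move=> pr_p; have p_gt0 := prime_gt0 pr_p.
pose P : {poly rat} := \prod_(1 <= i < p) (1 - 'X^i) - p%:R.
suff /dvdpP[q Pq] : \sum_(i < p) 'X^i %| P.
  by exists q; rewrite -Pq /P addrC subrK.
rewrite -(dvdp_map (@ratr algC)).
have [z z_prim] := C_prim_root_exists p_gt0.
have -> : map_poly ratr (\sum_(i < p) 'X^i) =
    \prod_(x <- [seq z ^+ i | i <- index_iota 1 p]) ('X - x%:P) :> {poly algC}.
  rewrite big_map rmorph_sum /=; under eq_bigr => i _ do rewrite map_polyXn.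
  apply: (mulfI (negbT (polyXsubC_eq0 1))).
  rewrite polyC1 -subrX1 -(factor_Xn_sub_1 z_prim) (big_ltn p_gt0).
  by rewrite expr0 polyC1.
apply: uniq_roots_dvdp; last first.
  rewrite uniq_rootsE map_inj_in_uniq ?iota_uniq // => i j.
  rewrite !mem_index_iota => /andP[_ ip] /andP[_ jp] /eqP.
  by rewrite (eq_prim_root_expr z_prim) !modn_small // => /eqP.
apply/allP=> _ /mapP[k + ->]; rewrite mem_index_iota => /andP[k_gt0 k_lt].
have zk_prim : p.-primitive_root (z ^+ k).
  rewrite prim_root_exp_coprime // coprime_sym prime_coprime //.
  by rewrite gtnNdvd.
rewrite /root /P rmorphB /= rmorph_nat rmorph_prod /= hornerD hornerN horner_prod.
rewrite -polyC_natr hornerC -{}[X in _ - X](prod_1_sub_prim_root p_gt0 zk_prim).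
rewrite subr_eq0; apply/eqP/eq_bigr=> i _.
by rewrite rmorphB /= rmorph1 map_polyXn hornerD hornerN hornerXn hornerC.
Qed.

(** Since $M-1$ is invertible and $M^p=1$, the sum $1+M+\dots+M^{p-1}$ vanishes, and only the
    constant $p$ survives in the polynomial identity. *)
Lemma prod_1_sub_exprM n p (M : 'M[rat]_n.+1) :
    prime p -> M ^+ p = 1 -> \det (M - 1) != 0 ->
  \prod_(1 <= i < p) (1 - M ^+ i) = p%:R.
Proof.
move=> pr_p Mp1 detM; have [q eq_q] := prod_1_sub_Xn_cyclotomic pr_p.
have sum0 : \sum_(i < p) M ^+ i = 0.
  apply: (@mulrI _ (M - 1)).
    by rewrite -[_ \is a _]/(M - 1 \in unitmx) unitmxE unitfE.
  by rewrite mulr0 -subrX1 Mp1 subrr.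
have := congr1 (horner_mx M) eq_q.
rewrite rmorph_prod rmorphD rmorphM rmorph_sum rmorph_nat /=.
under [X in _ = _ + _ * X -> _]eq_bigr => i _ do rewrite rmorphXn /= horner_mx_X.
rewrite sum0 mulr0 addr0 => <-; apply: eq_bigr => i _.
by rewrite rmorphB rmorph1 rmorphXn /= horner_mx_X.
Qed.

(** * Kernels of endomorphisms of a quotient by a subgroup or lattice *)

Lemma card_range_inj (T : finType) (U : choiceType) (h : T -> U) :
    injective h ->
  finite_set (range h) /\ #|` fset_set (range h)|%fset = #|T|.
Proof.
move=> inj_h; have -> : range h = [set` [fset h x | x in T]%fset].
  apply/seteqP; split=> [_ [x _ <-]|_ /= /imfsetP[x _ ->]]; last by exists x.
  by apply/imfsetP; exists x.
rewrite set_fsetK card_imfset //=; split; first exact: finite_fset.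
by rewrite cardE enumT unlock.
Qed.

Definition coset_of_set (V : zmodType) (Lam : set V) (x : V) : set V :=
  [set x + v | v in Lam].

(** When [f] is additive and preserves [Lam], this is the kernel of the induced endomorphism of
    $V/\mathrm{Lam}$, kept as a set of cosets to match [torus]. *)
Definition kernel_cosets (V : zmodType) (Lam : set V) (f : V -> V) :
    set (set V) :=
  [set coset_of_set Lam x | x in f @^-1` Lam].

Section KernelCosets.
Variables (V : zmodType) (Lam : set V).
Hypotheses (Lam0 : Lam 0) (LamB : forall x y, Lam x -> Lam y -> Lam (x - y)).
Implicit Types f g : {additive V -> V}.
Local Notation cls := (coset_of_set Lam).
Local Notation ker := (kernel_cosets Lam).

Lemma subgroup_opp x : Lam x -> Lam (- x).
Proof. by rewrite -sub0r; exact: LamB. Qed.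

Lemma subgroup_add x y : Lam x -> Lam y -> Lam (x + y).
Proof. by move=> Lx /subgroup_opp; rewrite -{2}[y]opprK; exact: LamB. Qed.

Lemma subgroup_muln x k : Lam x -> Lam (x *+ k).
Proof.
by move=> Lx; elim: k => [|k IH]; rewrite ?mulr0n // mulrS; exact: subgroup_add.
Qed.

Lemma coset_of_setP x y : cls x = cls y <-> Lam (x - y).
Proof.
split=> [e|Lxy].
  have : cls y x by rewrite -e; exists 0; rewrite ?addr0.
  by case=> v Lv <-; rewrite addrAC subrr add0r.
apply/seteqP; split=> [_ [v Lv <-]|_ [v Lv <-]].
  by exists (x - y + v); [exact: subgroup_add | rewrite addrA addrCA subrr addr0].
exists (v - (x - y)); first exact: LamB.
by rewrite opprB addrCA subrKC addrC.
Qed.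

Lemma kernel_cosets_sub f g : (forall x, Lam x -> Lam (g x)) ->
  ker f `<=` ker (g \o f).
Proof. by move=> gL _ [x Lfx <-]; exists x => //; exact: gL. Qed.

(* f maps the kernel of g \o f onto that of g, with fibres the cosets of the *)
(* kernel of f.                                                              *)
Lemma card_kernel_cosets_comp f g :
    (forall y, exists x, f x = y) ->
    (forall x, Lam x -> Lam (f x)) -> (forall x, Lam x -> Lam (g x)) ->
    finite_set (ker f) -> finite_set (ker g) ->
  finite_set (ker (g \o f)) /\
  #|` fset_set (ker (g \o f))|%fset =
    (#|` fset_set (ker g)|%fset * #|` fset_set (ker f)|%fset)%N.
Proof.
move=> f_surj fL gL fin_f fin_g.
set Kf := fset_set (ker f); set Kg := fset_set (ker g).
have memf (Z : Kf) : exists x, Lam (f x) /\ cls x = val Z.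
  by have := fsvalP Z; rewrite in_fset_set // inE => -[x Lx e]; exists x.
have memg (Y : Kg) : exists x, Lam (g (f x)) /\ cls (f x) = val Y.
  have := fsvalP Y; rewrite in_fset_set // inE => -[y Ly e].
  by have [x fx] := f_surj y; exists x; rewrite fx.
have [s sP] := choice memg; have [r rP] := choice memf.
(* [s] lifts a class in the kernel of [g] through [f], and [r] picks representatives in the kernel
   of [f]; adding them parametrizes the kernel of the composite. *)
pose h (YZ : Kg * Kf) := cls (s YZ.1 + r YZ.2).
have h_inj : injective h.
  move=> [Y Z] [Y' Z'] /coset_of_setP /= L1.
  have [[Lgs eY] [Lr eZ]] := (sP Y, rP Z).
  have [[Lgs' eY'] [Lr' eZ']] := (sP Y', rP Z').
  have YY : Y = Y'.
    apply: val_inj; rewrite /= -eY -eY'; apply/coset_of_setP.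
    (* Applying [f] to the difference of the two sums lands in [Lam], and so does the contribution
       of [r], which leaves the difference of the lifts. *)
    rewrite -raddfB /= -[s Y - s Y'](addrK (r Z - r Z')).
    rewrite raddfB; apply: LamB; last by rewrite raddfB; exact: LamB.
    by move: (fL _ L1); rewrite opprD addrACA.
  rewrite YY; congr pair; apply: val_inj; rewrite /= -eZ -eZ'.
  by apply/coset_of_setP; move: L1; rewrite YY opprD addrACA subrr add0r.
have -> : ker (g \o f) = range h.
  apply/seteqP; split=> [_ [x /= Lx <-]|_ [[Y Z] _ <-]]; last first.
    exists (s Y + r Z) => //=; rewrite !raddfD /=.
    by apply: subgroup_add; [exact: (sP Y).1 | exact/gL/(rP Z).1].
  have inY : cls (f x) \in Kg by rewrite in_fset_set // inE; exists (f x).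
  pose Y := [` inY]%fset; have [LY eY] := sP Y.
  have Lfx : Lam (f (x - s Y)) by rewrite raddfB; apply/coset_of_setP; rewrite eY.
  have inZ : cls (x - s Y) \in Kf by rewrite in_fset_set // inE; exists (x - s Y).
  pose Z := [` inZ]%fset; have [LZ eZ] := rP Z.
  exists (Y, Z) => //; apply/coset_of_setP => /=.
  have /coset_of_setP : cls (r Z) = cls (x - s Y) by [].
  by rewrite opprB addrA addrAC addrC addrA.
have [fin ->] := card_range_inj h_inj; split=> //.
by rewrite card_prod !cardfE.
Qed.

End KernelCosets.

Section MatrixKernel.
Variables (C : numFieldType) (n : nat) (Lam : set 'cV[C]_n.+1).
Hypotheses (Lam0 : Lam 0) (LamB : forall x y, Lam x -> Lam y -> Lam (x - y)).
Local Notation ker A := (kernel_cosets Lam (mulmx A)).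

Lemma card_kernel_cosets1 :
  finite_set (ker 1) /\ #|` fset_set (ker 1)|%fset = 1%N.
Proof.
have -> : ker 1 = [set coset_of_set Lam 0].
  apply/seteqP; split=> [_ [x /= + <-]|_ ->]; last by exists 0; rewrite //= mulmx0.
  by rewrite mul1mx => Lx; apply/coset_of_setP; rewrite // subr0.
by rewrite fset_set1 cardfs1.
Qed.

(** Induction on [s] with [card_kernel_cosets_comp]; invertibility of the factors supplies the
    surjectivity required there. *)
Lemma card_kernel_cosets_prod (I : eqType) (s : seq I)
    (A : I -> 'M[C]_n.+1) (N : nat) :
    (forall i, i \in s -> A i \in unitmx) ->
    (forall i x, Lam x -> Lam (A i *m x)) ->
    (forall i, i \in s -> finite_set (ker (A i)) /\
                          #|` fset_set (ker (A i))|%fset = N) ->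
  finite_set (ker (\prod_(i <- s) A i)) /\
  #|` fset_set (ker (\prod_(i <- s) A i))|%fset = (N ^ size s)%N.
Proof.
move=> + AL; elim: s => [|i s IH] unitA cardA.
  by rewrite big_nil; exact: card_kernel_cosets1.
have sub_s j : j \in s -> j \in i :: s by rewrite inE orbC => ->.
have [||fin_s card_s] := IH; try by move=> j /sub_s; auto.
have [fin_i card_i] := cardA i (mem_head i s).
pose B := \prod_(j <- s) A j.
have BL x : Lam x -> Lam (B *m x).
  rewrite /B; elim: (s) x => [|j t IHt] x Lx; first by rewrite big_nil mul1mx.
  by rewrite big_cons -mulmxA; apply/AL/IHt.
have unitB : B \in unitmx.
  rewrite /B big_seq; elim/big_rec: _ => [|j P /sub_s sj uP]; first exact: unitmx1.
  by rewrite unitmx_mul uP unitA.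
have -> : ker (\prod_(j <- i :: s) A j) =
    kernel_cosets Lam (mulmx (A i) \o mulmx B).
  by rewrite big_cons; congr kernel_cosets; apply/funext=> x /=; rewrite mulmxA.
have surjB (y : 'cV[C]_n.+1) : exists x, B *m x = y.
  by exists (invmx B *m y); rewrite mulKVmx.
have [fin ->] := card_kernel_cosets_comp Lam0 LamB (f := mulmx B)
  (g := mulmx (A i)) surjB BL (AL i) fin_s fin_i.
by rewrite card_i card_s expnS.
Qed.

Definition integral_span (E : 'M[C]_n.+1) : set 'cV[C]_n.+1 :=
  [set E *m map_mx intr z | z in [set: 'cV[int]_n.+1]].

(** The $p$-torsion is $\frac1p\mathrm{Lam}/\mathrm{Lam}$. In the basis given by the columns of [E],
    each class has a unique representative with coordinates $c_i/p$, $0\leq c_i<p$. *)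
Lemma card_kernel_cosets_natr (E : 'M[C]_n.+1) (p : nat) :
    E \in unitmx -> Lam = integral_span E -> (0 < p)%N ->
  finite_set (ker p%:R) /\ #|` fset_set (ker p%:R)|%fset = (p ^ n.+1)%N.
Proof.
move=> unitE defL p_gt0.
have pC : p%:R != 0 :> C by rewrite pnatr_eq0 -lt0n.
have mulp (x : 'cV[C]_n.+1) : p%:R *m x = p%:R *: x.
  by rewrite -mul_scalar_mx rmorph_nat.
pose h (c : 'cV['I_p]_n.+1) : set 'cV[C]_n.+1 :=
  coset_of_set Lam (p%:R^-1 *: (E *m map_mx (fun i : 'I_p => (i : nat)%:R) c)).
have h_inj : injective h.
  move=> c d /(coset_of_setP Lam0 LamB).
  rewrite -scalerBr -mulmxBr defL => -[z _ /(congr1 ( *:%R p%:R))].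
  rewrite scalerA mulfV // scale1r scalemxAr => /(can_inj (mulKmx unitE)).
  move/matrixP=> e; apply/matrixP=> i j; apply: val_inj => /=.
  have := e i j; rewrite !mxE !pmulrn -intrM -intrB => /intr_inj e'.
  have : (Posz (c i j) %% p)%Z = (Posz (d i j) %% p)%Z.
    by rewrite -(subrK (Posz (d i j)) (Posz (c i j))) -e' mulrC modzMDl.
  by rewrite !modz_nat !modn_small // => -[].
have -> : ker p%:R = range h.
  apply/seteqP; split=> [_ [x /= + <-]|_ [c _ <-]]; last first.
    exists (p%:R^-1 *: (E *m map_mx (fun i : 'I_p => (i : nat)%:R) c)) => //=.
    rewrite mulp scalerA mulfV // scale1r defL.
    exists (map_mx (fun i : 'I_p => Posz i) c) => //.
    by congr (_ *m _); apply/matrixP=> i j; rewrite !mxE.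
  rewrite mulp defL => -[z _ ez].
  have c_lt i j : (`|(z i j %% p)%Z| < p)%N.
    by rewrite -ltz_nat gez0_abs ?modz_ge0 ?ltz_pmod // eqz_nat -lt0n.
  (* The remainders modulo $p$ are the digits; the quotients give the lattice vector separating [x]
     from its representative. *)
  exists (\matrix_(i, j) Ordinal (c_lt i j)) => //.
  rewrite -defL; apply/(coset_of_setP Lam0 LamB).
  have -> : x = p%:R^-1 *: (E *m map_mx intr z).
    by rewrite ez scalerA mulVf // scale1r.
  rewrite defL -scalerBr -mulmxBr; exists (- map_mx (divz^~ p) z) => //.
  rewrite scalemxAr; congr (_ *m _); apply/matrixP=> i j; rewrite !mxE.
  apply: (mulfI pC); rewrite mulrA mulfV // mul1r !pmulrn -intrB -!intrM.
  rewrite gez0_abs ?modz_ge0 ?eqz_nat -?lt0n //.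
  congr (_%:~R).
  by rewrite [X in _ = _ - X](divz_eq (z i j) p) opprD addrCA subrr addr0
    mulrC mulNr.
have [fin ->] := card_range_inj h_inj; split=> //.
by rewrite card_mx card_ord muln1.
Qed.

End MatrixKernel.

(** * Sets glued at a point, elements of prescribed order, lattice bases *)

(** By induction, inclusion-exclusion at each step removes only [z]. Putting [size s] on the left
    avoids truncated subtraction. *)
Lemma card_bouquet (T : choiceType) (I : eqType) (s : seq I) (z : T)
    (K : I -> set T) :
    uniq s -> (0 < size s)%N ->
    (forall i, i \in s -> finite_set (K i) /\ K i z) ->
    (forall i j, i \in s -> j \in s -> i != j -> K i `&` K j `<=` [set z]) ->
  let U := [set x | exists2 i, i \in s & K i x] in
  finite_set U /\
  (#|` fset_set U|%fset + size s =
     1 + \sum_(i <- s) #|` fset_set (K i)|%fset)%N.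
Proof.
elim: s => [//|i s IH] /=/andP[si us] _ Kfz KI.
have [Kif Kiz] := Kfz i (mem_head i s).
have sub_s j : j \in s -> j \in i :: s by rewrite inE orbC => ->.
have [s0|s_gt0] := posnP (size s).
  rewrite (size0nil s0).
  have -> : [set x | exists2 j, j \in [:: i] & K j x] = K i.
    apply/seteqP; split=> [x [j]|x Kx]; last by exists i; rewrite ?mem_head.
    by rewrite inE => /eqP->.
  by rewrite big_seq1 addn1 add1n.
have [|j k /sub_s ? /sub_s|] := IH us s_gt0; [by move=> j /sub_s/Kfz| exact: KI|].
set U := [set x | exists2 j, j \in s & K j x] => Uf cardU.
have -> : [set x | exists2 j, j \in i :: s & K j x] = K i `|` U.
  apply/seteqP; split=> x.
    move=> [j + Kx]; rewrite inE => /orP[/eqP <-|js]; [by left|right].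
    by exists j.
  by move=> [Kx|[j /sub_s js Kx]]; [exists i; rewrite ?mem_head|exists j].
split; first by rewrite finite_setU.
have := cardfsUI (fset_set (K i)) (fset_set U); rewrite -fset_setI //.
have -> : K i `&` U = [set z].
  apply/seteqP; split=> [x [Kx [j js Kjx]]|_ ->].
    apply: (KI i j (mem_head i s) (sub_s _ js)) => //.
    by apply: contraNneq si => ->.
  have [j js] : exists j, j \in s.
    by case: (s) s_gt0 => // j ? _; exists j; exact: mem_head.
  by split=> //; exists j => //; have [] := Kfz j (sub_s _ js).
rewrite fset_set1 cardfs1 fset_setU // big_cons => UI.
by rewrite addnS -addSn -addn1 UI -addnA cardU addnCA.
Qed.

Lemma order_expg_divn (gT : finGroupType) (a : gT) (p : nat) :
  (p %| #[a]%g)%N -> #[a ^+ (#[a] %/ p)]%g = p.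
Proof.
move=> p_a; have := order_gt0 a; rewrite orderXdiv ?dvdn_div // -{1 2}(divnK p_a).
by rewrite muln_gt0 => /andP[q_gt0 _]; rewrite mulKn.
Qed.

Lemma full_rank_lattice_span n (L : set 'cV[rat]_n) : full_rank_lattice L ->
  exists2 E : 'M[rat]_n, E \in unitmx &
    L = [set E *m map_mx intr z | z in [set: 'cV[int]_n]].
Proof.
move=> [e /basis_free/freeP free_e ->].
pose E : 'M[rat]_n := \matrix_(i, j) e`_j i 0.
have mulE (k : 'cV[rat]_n) : E *m k = \sum_(i < n) k i 0 *: e`_i.
  apply/matrixP=> i j; rewrite ord1 !mxE summxE; apply: eq_bigr => l _.
  by rewrite !mxE mulrC.
exists E.
  (* A row vector killed by the transpose of [E] is a linear relation between the basis vectors. *)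
  rewrite unitmxE unitfE -det_tr; apply/negP=> /det0P[v v0 vE].
  case/negP: v0; apply/eqP/matrixP=> i j; rewrite ord1 mxE.
  apply: (free_e (fun k => v 0 k)).
  transitivity (E *m v^T); last by rewrite -[E]trmxK -trmx_mul vE trmx0.
  by rewrite mulE; apply: eq_bigr => k _; rewrite mxE.
apply/seteqP; split=> [_ [z _ <-]|_ [z _ <-]].
  exists (\col_i z i) => //; rewrite mulE; apply: eq_bigr => i _.
  by rewrite !mxE scaler_int.
exists (fun i => z i 0) => //; rewrite mulE; apply: eq_bigr => i _.
by rewrite !mxE scaler_int.
Qed.

(** * Fixed loci on the torus *)

Section FixedPoints.
Variables (R : realType) (gT : finGroupType) (G : {group gT}) (n : nat).
Variables (rG : mx_representation rat G n.+1) (L : set 'cV[rat]_n.+1).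
Hypotheses (fpf : rational_FPF rG) (latL : full_rank_lattice L).
Hypothesis stL : invariant_set rG L.

Let Lam : set 'cV[R[i]]_n.+1 := map_mx ratr @` L.
Let rho (g : gT) : 'M[R[i]]_n.+1 := map_mx ratr (rG g).

Definition fixed_classes (g : gT) : set (set 'cV[R[i]]_n.+1) :=
  [set X | torus R L X /\ torus_act rG g X = X].

Lemma lattice_image_span :
  exists2 E : 'M[R[i]]_n.+1, E \in unitmx & Lam = integral_span E.
Proof.
have [E uE eL] := full_rank_lattice_span latL.
exists (map_mx ratr E); first by rewrite map_unitmx.
have e z : map_mx ratr (E *m map_mx intr z) =
    map_mx ratr E *m map_mx intr z :> 'cV[R[i]]_n.+1.
  rewrite map_mxM; congr (_ *m _); apply/matrixP=> i j.
  by rewrite !mxE rmorph_int.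
rewrite /Lam eL; apply/seteqP; split=> [_ [_ [z _ <-] <-]|_ [z _ <-]].
  by exists z.
by exists (E *m map_mx intr z); [exists z | rewrite e].
Qed.

Lemma lattice_image0 : Lam 0.
Proof.
have [E _ ->] := lattice_image_span; exists 0 => //.
by rewrite map_mx0 mulmx0.
Qed.

Lemma lattice_imageB x y : Lam x -> Lam y -> Lam (x - y).
Proof.
have [E _ ->] := lattice_image_span => -[z _ <-] [t _ <-].
by exists (z - t); rewrite // map_mxB mulmxBr.
Qed.

Let Lam0 := lattice_image0.
Let LamB := lattice_imageB.

Lemma lattice_image_act g x : g \in G -> Lam x -> Lam (rho g *m x).
Proof.
move=> Gg [v Lv <-]; exists (rG g *m v); first exact: stL.
by rewrite map_mxM.
Qed.

Lemma torus_class_coset x : torus_class L x = coset_of_set Lam x.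
Proof.
apply/seteqP; split=> [_ [v Lv <-]|_ [_ [v Lv <-] <-]]; last by exists v.
by exists (map_mx ratr v) => //; exists v.
Qed.

(** $g[x]=[x]$ means $gx-x\in\mathrm{Lam}$, which turns the fixed locus into a kernel. *)
Lemma fixed_classesE g : g \in G ->
  fixed_classes g = kernel_cosets Lam (mulmx (1 - rho g)).
Proof.
move=> Gg.
have fixE x : torus_act rG g (torus_class L x) = torus_class L x <->
    Lam ((1 - rho g) *m x).
  rewrite (torus_act_class _ stL Gg) !torus_class_coset.
  split=> [/(coset_of_setP Lam0 LamB)|] LL.
    by rewrite mulmxBl mul1mx -opprB; exact: (subgroup_opp Lam0 LamB).
  apply/(coset_of_setP Lam0 LamB); rewrite -opprB.
  by apply: (subgroup_opp Lam0 LamB); rewrite -[X in X - _]mul1mx -mulmxBl.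
apply/seteqP; split=> [_ [[x _ <-] /fixE Lx]|_ [x /fixE Lx <-]].
  by exists x; rewrite // torus_class_coset.
by rewrite -torus_class_coset; split=> //; exists x.
Qed.

Lemma fixed_classes_cycle g h : g \in G -> h \in <[g]>%g ->
  fixed_classes g `<=` fixed_classes h.
Proof.
move=> Gg /cycleP[k ->] _ [[x _ <-] gX]; split; first by exists x.
elim: k => [|k IH].
  by rewrite expg0 (torus_act_class _ stL) // repr_mx1 map_mx1 mul1mx.
rewrite (torus_act_class _ stL) ?groupX // expgS repr_mxM ?groupX // map_mxM.
by rewrite -mulmxA -!(torus_act_class _ stL) ?groupX // IH.
Qed.

Lemma fixed_classes_generator g h : g \in G -> generator <[g]>%g h ->
  fixed_classes h = fixed_classes g.
Proof.
move=> Gg gen; have Ggh : h \in <[g]>%g by rewrite cycle_generator.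
have Gh : h \in G by apply: fintype.subsetP Ggh; rewrite cycle_subG.
apply/seteqP; split; apply: fixed_classes_cycle => //.
by rewrite -(eqP gen) cycle_id.
Qed.

Lemma fixed_classes0 g : g \in G -> fixed_classes g (coset_of_set Lam 0).
Proof.
by move=> Gg; rewrite fixed_classesE //; exists 0; rewrite //= mulmx0.
Qed.

Section PrimeOrder.
Variable g : gT.
Hypotheses (Gg : g \in G) (pr_g : prime #[g]%g).

Lemma rho_expr i : 1 - rho g ^+ i = 1 - rho (g ^+ i)%g.
Proof. by rewrite /rho repr_mxX // rmorphXn. Qed.

Lemma prod_1_sub_rho : \prod_(1 <= i < #[g]%g) (1 - rho g ^+ i) = #[g]%g%:R.
Proof.
have := @prod_1_sub_exprM _ _ (rG g) pr_g.
rewrite -repr_mxX // expg_order repr_mx1 => /(_ erefl).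
have g_neq1 : g != 1%g by rewrite -order_eq1 neq_ltn prime_gt1 ?orbT.
move=> /(_ (fpf.2 g Gg g_neq1))/(congr1 (map_mx (@ratr R[i]))).
rewrite rmorph_nat rmorph_prod /= => <-; apply: eq_bigr => i _.
by rewrite rmorphB rmorph1 rmorphXn.
Qed.

Lemma sub_rho_lattice i x : Lam x -> Lam ((1 - rho g ^+ i) *m x).
Proof.
move=> Lx; rewrite rho_expr mulmxBl mul1mx; apply: LamB => //.
by apply: lattice_image_act => //; rewrite groupX.
Qed.

(** For prime order $p$ and $0<i<p$, $g^i$ generates $\langle g\rangle$, so it has the same fixed
    points as $g$. *)
Lemma fixed_classes_expr i : (0 < i < #[g]%g)%N ->
  kernel_cosets Lam (mulmx (1 - rho g ^+ i)) = fixed_classes g.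
Proof.
move=> /andP[i_gt0 i_lt]; rewrite rho_expr -fixed_classesE ?groupX //.
apply: fixed_classes_generator => //.
by rewrite generator_coprime prime_coprime // gtnNdvd.
Qed.

(** In $p=\prod_{0<i<p}(1-g^i)$ the last factor already kills the fixed locus, and the remaining
    ones preserve the lattice. *)
Lemma fixed_classes_sub_torsion :
  fixed_classes g `<=` kernel_cosets Lam (mulmx #[g]%g%:R).
Proof.
have := prime_gt1 pr_g; rewrite -prod_1_sub_rho.
case def_p: #[g]%g => [//|[//|k]] _.
rewrite big_nat_recr //=; set P := \prod_(_ <= _ < _) _.
rewrite -(@fixed_classes_expr k.+1) ?def_p //.
rewrite [X in _ `<=` kernel_cosets _ X](_ : _ =
  mulmx P \o mulmx (1 - rho g ^+ k.+1)).
  apply: kernel_cosets_sub => x /=; rewrite /P.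
  elim: (index_iota _ _) x => [|j t IH] x Lx; first by rewrite big_nil mul1mx.
  by rewrite big_cons -mulmxA; apply/sub_rho_lattice/IH.
by apply/funext => x /=; rewrite mulmxA.
by rewrite ltnSn.
Qed.

(** The $p-1$ factors of $p$ have equal kernels, so the order of the $p$-torsion is the $(p-1)$-st
    power of that of the locus. The root is extracted later, in the reals. *)
Lemma card_fixed_classes_expr :
  finite_set (fixed_classes g) /\
  (#|` fset_set (fixed_classes g)|%fset ^ #[g]%g.-1 = #[g]%g ^ n.+1)%N.
Proof.
have [E uE eL] := lattice_image_span.
have [fin_p card_p] := card_kernel_cosets_natr Lam0 LamB uE eL (prime_gt0 pr_g).
have fin_g : finite_set (fixed_classes g).
  exact: sub_finite_set fixed_classes_sub_torsion fin_p.
split=> //; rewrite -card_p -prod_1_sub_rho.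
have [|i x|i|_ ->] := @card_kernel_cosets_prod _ _ _ Lam0 LamB _
    (index_iota 1 #[g]%g) (fun i => 1 - rho g ^+ i)
    #|` fset_set (fixed_classes g)|%fset.
- move=> i; rewrite mem_index_iota => /andP[i_gt0 i_lt].
  have -> : 1 - rho g ^+ i = map_mx ratr (1 - rG (g ^+ i)%g).
    by rewrite rho_expr rmorphB rmorph1.
  rewrite map_unitmx unitmxE unitfE.
  rewrite -opprB -scaleN1r detZ mulf_neq0 ?expf_neq0 ?oppr_eq0 ?oner_eq0 //.
  by apply: fpf.2; rewrite ?groupX // -order_dvdn gtnNdvd.
- exact: sub_rho_lattice.
- by rewrite mem_index_iota => /fixed_classes_expr ->.
by rewrite size_iota subn1.
Qed.

End PrimeOrder.

Lemma fixed_classes_disjoint g h : g \in G -> h \in G ->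
    prime #[g]%g -> prime #[h]%g -> #[g]%g != #[h]%g ->
  fixed_classes g `&` fixed_classes h `<=` [set coset_of_set Lam 0].
Proof.
move=> Gg Gh pr_g pr_h neq_gh _ [] /(fixed_classes_sub_torsion Gg pr_g)[x /= gx <-].
move/(fixed_classes_sub_torsion Gh pr_h)=> [y /= hy /(coset_of_setP Lam0 LamB) xy].
have mulnE k (v : 'cV[R[i]]_n.+1) : k%:R *m v = v *+ k.
  by rewrite -(rmorph_nat (@scalar_mx _ _)) mul_scalar_mx scaler_nat.
have {y hy xy}hx : Lam (#[h]%g%:R *m x).
  have -> : x = y - (y - x) by rewrite subKr.
  rewrite mulmxBr; apply: LamB => //.
  by rewrite mulnE; exact: subgroup_muln.
apply/(coset_of_setP Lam0 LamB); rewrite subr0.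
(* Bezout with natural coefficients: $1+k\,|h|=l\,|g|$, so $x$ is a difference of two multiples
   lying in the lattice. *)
have [k _ /dvdnP[l]] := Bezoutl #[h]%g (prime_gt0 pr_g).
have /eqP -> : coprime #[g]%g #[h]%g.
  by rewrite prime_coprime // dvdn_prime2.
move=> e; have -> : x = x *+ (#[g]%g * l) - x *+ (#[h]%g * k).
  by rewrite ![(#[_]%g * _)%N]mulnC -e mulrnDr mulr1n addrK.
rewrite !mulnE in gx hx.
by apply: LamB; rewrite mulrnA; exact: subgroup_muln.
Qed.

(** A nontrivial stabilizer contains some [h] of prime order $p$. It lies in $\langle a\rangle$,
    whose only subgroup of order $p$ is generated by $a^{|a|/p}$, so that power fixes the point
    too. *)
Lemma nontrivial_stabilizer_pointsE a :
    a \in G ->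
    (forall h, h \in G -> prime #[h]%g -> h \in <[a]>%g) ->
  nontrivial_stabilizer_points R rG L =
  [set X | exists2 p, p \in primes #[a]%g &
                      fixed_classes (a ^+ (#[a] %/ p))%g X].
Proof.
move=> Ga pr_a; apply/seteqP; split=> X; last first.
  move=> [p + [TX fX]]; rewrite mem_primes => /and3P[p_pr _ p_dvd]; split=> //.
  have : (a ^+ (#[a] %/ p) \in torus_stabilizer rG X)%g.
    by rewrite inE groupX //; exact/asboolP.
  apply: contraTneq => ->; rewrite inE -order_dvdn gtnNdvd ?divn_gt0 ?prime_gt0 //.
    by rewrite dvdn_leq.
  by rewrite ltn_Pdiv ?prime_gt1.
move=> [TX stabX].
have [g] : exists2 g, g \in torus_stabilizer rG X & g \notin [1 gT]%g.
  apply/fintype.subsetPn; apply: contraNN stabX => sub1.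
  rewrite finset.eqEsubset sub1 finset.sub1set inE group1; apply/asboolP.
  move: TX => [x _ <-].
  by rewrite (torus_act_class _ stL) // repr_mx1 map_mx1 mul1mx.
rewrite !inE => /andP[Gg /asboolP gX]; rewrite -order_gt1 => g_gt1.
pose p := pdiv #[g]%g; pose h := (g ^+ (#[g] %/ p))%g.
have p_pr : prime p by exact: pdiv_prime.
have oh : #[h]%g = p by rewrite order_expg_divn ?pdiv_dvd.
have Gh : h \in G by rewrite groupX.
have Ah : h \in <[a]>%g by apply: pr_a => //; rewrite oh.
have p_a : (p %| #[a]%g)%N by rewrite -oh order_dvdG.
have Gap : (a ^+ (#[a] %/ p))%g \in G by rewrite groupX.
exists p; first by rewrite mem_primes p_pr order_gt0.
apply: (@fixed_classes_cycle h) => //; last first.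
  by apply: (@fixed_classes_cycle g); rewrite ?mem_cycle.
(* Subgroups of a cyclic group are determined by their order. *)
suff /eqP -> : <[h]>%g == <[(a ^+ (#[a] %/ p))%g]>%g by exact: cycle_id.
rewrite (eq_subG_cyclic (cycle_cyclic a)) ?cycle_subG ?mem_cycle //.
by rewrite -!orderE oh order_expg_divn.
Qed.

End FixedPoints.

Arguments fixed_classes R {gT G n} rG L g.

(** * Real exponents and the final count *)

Lemma powR_natr_root (R : realType) (N p n k : nat) : (0 < k)%N ->
  (N ^ k = p ^ n)%N -> N%:R = p%:R `^ (n%:R / k%:R) :> R.
Proof.
move=> k_gt0 e; rewrite powRrM powR_mulrn // -natrX -e natrX -powR_mulrn //.
by rewrite -powRrM mulfV ?powRr1 // pnatr_eq0 -lt0n.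
Qed.

Theorem theorem4p6 (R : realType) (m : nat) (gT : finGroupType)
    (G : {group gT}) (n : nat) (rG : mx_representation rat G n)
    (L : set 'cV[rat]_n) :
  (2 <= m)%N ->
  (G \isog Grp (a : b : a ^+ (2 * m), b ^+ 2 = a ^+ m,
                        b * a * b^-1 = a^-1))%g ->
  rational_FPF rG ->
  full_rank_lattice L ->
  invariant_set rG L ->
  let F := nontrivial_stabilizer_points R rG L in
  finite_set F /\
  (#|` fset_set F|%fset)%:R =
    1 - (size (primes (2 * m)))%:R
      + \sum_(p <- primes (2 * m)) p%:R `^ (n%:R / (p.-1)%:R) :> R.
Proof.
(* Dimension $0$ is excluded by [rational_FPF]; a successor dimension gives square matrices their
   ring structure. *)
case: n rG L => [|n] rG L m_gt1 isoG fpf latL stL; first by case: fpf.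
have m_gt0 : (0 < m)%N by exact: ltnW.
have [a [Ga oa pr_a]] := quaternion_presentation_cyclic m_gt0 isoG.
rewrite /= (nontrivial_stabilizer_pointsE R stL Ga pr_a) oa.
have N_gt0 : (0 < 2 * m)%N by rewrite muln_gt0.
have op p : p \in primes (2 * m) -> #[a ^+ (2 * m %/ p)]%g = p.
  by rewrite mem_primes -oa => /and3P[_ _]; exact: order_expg_divn.
have pr p : p \in primes (2 * m) -> prime p by rewrite mem_primes => /andP[].
have Gap p : (a ^+ (2 * m %/ p))%g \in G by rewrite groupX.
have cardK p : p \in primes (2 * m) ->
    let K := fixed_classes R rG L (a ^+ (2 * m %/ p))%g in
    finite_set K /\ (#|` fset_set K|%fset ^ p.-1 = p ^ n.+1)%N.
  move=> pP; have := card_fixed_classes_expr R fpf latL stL (Gap p).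
  by rewrite op //; apply; exact: pr.
have [||p pP|p q pP qP pq|finF cardF] := @card_bouquet _ _ (primes (2 * m))
  (coset_of_set (map_mx ratr @` L) 0)
  (fun p => fixed_classes R rG L (a ^+ (2 * m %/ p))%g).
- exact: primes_uniq.
(* The prime $2$ makes the family of loci nonempty, as [card_bouquet] requires. *)
- have : 2 \in primes (2 * m) by rewrite mem_primes N_gt0 dvdn_mulr.
  by case: primes.
- by split; [exact: (cardK p pP).1 | exact: fixed_classes0].
- by apply: fixed_classes_disjoint; rewrite ?op ?pr.
split=> //; move/(congr1 (fun k => k%:R : R)): cardF; rewrite !natrD.
move/(canRL (addrK _)) => ->; rewrite addrAC; congr (_ + _).
rewrite natr_sum; apply: eq_big_seq => p pP; apply: powR_natr_root.
  by rewrite -subn1 subn_gt0 prime_gt1 ?pr.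
exact: (cardK p pP).2.
Qed.
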